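(* Let $\mathbb{F}$ be a field of characteristic $0$, and let $\mathcal{D}_\infty=\langle z,s : s^2=1,\ s^{-1}zs=z^{-1}\rangle$ be the infinite dihedral group, with $\mathcal{Z}=\langle z\rangle$. Let $\mathcal{A}$ be a Schur ring over $\mathcal{D}_\infty$, let $\mathcal{D}$ be the set of basic sets of $\mathcal{A}$, and let $C\in\mathcal{D}$ be the basic set containing $z$. Then the following statements hold. (i) If $C\subseteq\mathcal{Z}$, then $\langle z\rangle$ is an $\mathcal{A}$-subgroup. (ii) Suppose that $C$ contains an element of the form $z^is$ with $i\in\mathbb{Z}$. Then there exist at least two elements $z^is$ and $z^js$ with $i\neq j$ in $C$. (iii) Set $$l:=\max_{D\in\mathcal{D}}\{\,i-j : z^is,\,z^js\in D\,\}\quad\text{and}\quad t:=\min_{D\in\mathcal{D}}\{\,|i-j| : z^is,\,z^js\in D,\ i\neq j\,\},$$ that is, $l$ is the maximum of all differences $i-j$, and $t$ the minimum of all $|i-j|$ with $i\ne j$, where $i,j\in\mathbb{Z}$ are such that $z^is$ and $z^js$ lie in a common basic set of $\mathcal{A}$. Suppose that (the maximum $l$ exists and) $2\nmid l$ and $t>2$. Then $\mathcal{Z}$ is an $\mathcal{A}$-subgroup.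
   Context: Let $G$ be a group and $\mathbb{F}$ a field of characteristic $0$. For a finite non-empty subset $C\subseteq G$ put $\underline{C}=\sum_{g\in C}g\in\mathbb{F}[G]$ and $C^*=\{g^{-1}: g\in C\}$. Schur ring: let $\mathcal{D}$ be a partition of $G$ all of whose parts are finite, and let $\mathcal{A}$ be the $\mathbb{F}$-subspace of $\mathbb{F}[G]$ spanned by $\{\underline{C}: C\in\mathcal{D}\}$. Then $\mathcal{A}$ is a Schur ring over $G$ if (1) $\{1\}\in\mathcal{D}$; (2) $C^*\in\mathcal{D}$ for every $C\in\mathcal{D}$; (3) for all $C,D\in\mathcal{D}$, $\underline{C}\cdot\underline{D}=\sum_{E\in\mathcal{D}}\lambda_{CDE}\underline{E}$, where all but finitely many $\lambda_{CDE}$ are $0$. The elements of $\mathcal{D}=\mathcal{D}(\mathcal{A})$ are called the basic sets of $\mathcal{A}$. An $\mathcal{A}$-set is a union of basic sets of $\mathcal{A}$; an $\mathcal{A}$-subgroup is a subgroup of $G$ that is an $\mathcal{A}$-set. *)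

(* Defs.v *)
From HB Require Import structures.
From mathcomp Require Import all_boot all_order all_algebra.
From mathcomp Require Import finmap monalg.
From mathcomp Require Import boolp classical_sets.
From mathcomp Require Import ring.

Set Implicit Arguments.
Unset Strict Implicit.
Unset Printing Implicit Defensive.

Import Order.TTheory GRing.Theory Num.Theory.

Local Open Scope fset_scope.
Local Open Scope classical_set_scope.
Local Open Scope ring_scope.

(* The library equips [{malg R[K]}] with a product only for [K : monomType],
   and a [monomType] has no units but [1]; so the convolution product over a
   group is set up here, on an alias of the same module. *)
Definition groupAlg (R : nzRingType) (G : groupType) : Type := {malg R[G]}.

Notation "{ 'galg' R [ G ] }" := (groupAlg R G)
  (at level 0, R, G at level 2, format "{ 'galg'  R [ G ] }") : type_scope.

HB.instance Definition _ (R : nzRingType) (G : groupType) :=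
  GRing.Lmodule.copy {galg R[G]} {malg R[G]}.

Section GroupAlgRing.
Context (R : nzRingType) (G : groupType).
Implicit Types (g : {galg R[G]}) (k : G).

Definition galg_one : {galg R[G]} := << 1%g >>.

Definition galg_mul g1 g2 : {galg R[G]} :=
  \sum_(k1 <- msupp g1) \sum_(k2 <- msupp g2)
     << mcoeff k1 g1 * mcoeff k2 g2 *g (k1 * k2)%g >>.

Lemma galg_mulw (d1 d2 : {fset G}) g1 g2 :
  (msupp g1 `<=` d1)%fset -> (msupp g2 `<=` d2)%fset ->
  galg_mul g1 g2 =
    \sum_(k1 <- d1) \sum_(k2 <- d2)
      << mcoeff k1 g1 * mcoeff k2 g2 *g (k1 * k2)%g >>.
Proof.
move=> le_d1 le_d2; rewrite /galg_mul (big_fset_incl _ le_d1) /=.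
  apply/eq_bigr=> k1 _; apply/big_fset_incl => // k _ /mcoeff_outdom ->.
  by rewrite mulr0 monalgU0.
move=> k _ /mcoeff_outdom g1k.
by rewrite big1 => // k' _; rewrite g1k mul0r monalgU0.
Qed.

Lemma galg_mulrw (d1 d2 : {fset G}) g1 g2 :
  (msupp g1 `<=` d1)%fset -> (msupp g2 `<=` d2)%fset ->
  galg_mul g1 g2 =
    \sum_(k2 <- d2) \sum_(k1 <- d1)
      << mcoeff k1 g1 * mcoeff k2 g2 *g (k1 * k2)%g >>.
Proof. by move=> le_d1 le_d2; rewrite (galg_mulw le_d1 le_d2) exchange_big. Qed.

Lemma galg_mulUU c1 c2 k1 k2 :
  galg_mul << c1 *g k1 >> << c2 *g k2 >> = << c1 * c2 *g (k1 * k2)%g >>.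
Proof. by rewrite (galg_mulw msuppU_le msuppU_le) !big_seq_fset1 !mcoeffUU. Qed.

Lemma galg_mul0g : left_zero 0 galg_mul.
Proof. by move=> g; rewrite /galg_mul msupp0 big_seq_fset0. Qed.

Lemma galg_mulg0 : right_zero 0 galg_mul.
Proof.
by move=> g; rewrite /galg_mul big1 // => k _; rewrite msupp0 big_seq_fset0.
Qed.

Lemma galg_mulUg c k g :
  galg_mul << c *g k >> g =
    \sum_(k' <- msupp g) << c * mcoeff k' g *g (k * k')%g >>.
Proof.
rewrite (galg_mulw msuppU_le (fsubset_refl _)) big_seq_fset1.
by apply/eq_bigr => k' _; rewrite mcoeffUU.
Qed.

Lemma galg_mulgU c k g :
  galg_mul g << c *g k >> =
    \sum_(k' <- msupp g) << mcoeff k' g * c *g (k' * k)%g >>.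
Proof.
rewrite (galg_mulrw (fsubset_refl _) msuppU_le) big_seq_fset1.
by apply/eq_bigr=> k' _; rewrite mcoeffUU.
Qed.

Lemma galg_mulEl g1 g2 :
  galg_mul g1 g2 = \sum_(k1 <- msupp g1) galg_mul << mcoeff k1 g1 *g k1 >> g2.
Proof. by apply/eq_bigr=> k _; rewrite galg_mulUg. Qed.

Lemma galg_mulEr g1 g2 :
  galg_mul g1 g2 = \sum_(k2 <- msupp g2) galg_mul g1 << mcoeff k2 g2 *g k2 >>.
Proof.
rewrite (galg_mulrw (fsubset_refl _) (fsubset_refl _)).
by apply/eq_bigr=> k _; rewrite galg_mulgU.
Qed.

Lemma galg_mul1g : left_id galg_one galg_mul.
Proof.
move=> g; rewrite galg_mulUg [RHS]monalgE.
by apply/eq_bigr=> kg _; rewrite mul1r mul1g.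
Qed.

Lemma galg_mulg1 : right_id galg_one galg_mul.
Proof.
move=> g; rewrite galg_mulgU [RHS]monalgE.
by apply/eq_bigr=> k _; rewrite mulr1 mulg1.
Qed.

Lemma galg_mulDl : left_distributive galg_mul +%R.
Proof.
move=> g1 g2 g.
rewrite [in RHS](galg_mulw (fsubsetUl _ (msupp g2)) (fsubset_refl _)).
rewrite [in RHS](galg_mulw (fsubsetUr (msupp g1) _) (fsubset_refl _)).
rewrite (galg_mulw (msuppD_le _ _) (fsubset_refl _)).
rewrite -big_split /=; apply/eq_bigr=> k1 _.
rewrite -big_split /=; apply/eq_bigr=> k2 _.
by rewrite mcoeffD mulrDl monalgUD.
Qed.

Lemma galg_mulDr : right_distributive galg_mul +%R.
Proof.
move=> g g1 g2.
rewrite [in RHS](galg_mulrw (fsubset_refl _) (fsubsetUl _ (msupp g2))).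
rewrite [in RHS](galg_mulrw (fsubset_refl _) (fsubsetUr (msupp g1) _)).
rewrite (galg_mulrw (fsubset_refl _) (msuppD_le _ _)).
rewrite -big_split /=; apply/eq_bigr => k1 _.
rewrite -big_split /=; apply/eq_bigr => k2 _.
by rewrite mcoeffD mulrDr monalgUD.
Qed.

Lemma galg_mul_suml I (r : seq I) (E : I -> {galg R[G]}) g :
  galg_mul (\sum_(i <- r) E i) g = \sum_(i <- r) galg_mul (E i) g.
Proof.
exact: (big_morph (galg_mul^~ g) (fun _ _ => galg_mulDl _ _ _) (galg_mul0g _)).
Qed.

Lemma galg_mul_sumr I (r : seq I) (E : I -> {galg R[G]}) g :
  galg_mul g (\sum_(i <- r) E i) = \sum_(i <- r) galg_mul g (E i).
Proof.
exact: (big_morph (galg_mul g) (fun _ _ => galg_mulDr _ _ _) (galg_mulg0 _)).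
Qed.

Lemma galg_mulA : associative galg_mul.
Proof.
move=> g1 g2 g3.
rewrite [LHS]galg_mulEl (galg_mulEl g1 g2) galg_mul_suml.
apply/eq_bigr=> k1 _.
rewrite (galg_mulEl g2 g3) (galg_mulEr _ g2) galg_mul_sumr galg_mul_suml.
apply/eq_bigr=> k2 _.
rewrite (galg_mulEr _ g3) [RHS]galg_mulEr galg_mul_sumr.
by apply/eq_bigr=> k3 _; rewrite !galg_mulUU mulrA mulgA.
Qed.

Lemma galg_one_neq0 : galg_one != 0.
Proof. by apply/eqP/malgP=> /(_ 1%g) /eqP; rewrite !mcoeffsE oner_eq0. Qed.

HB.instance Definition _ := GRing.Zmodule_isNzRing.Build {galg R[G]}
  galg_mulA galg_mul1g galg_mulg1 galg_mulDl galg_mulDr galg_one_neq0.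

End GroupAlgRing.

Section SchurRing.
Context (F : fieldType) (G : groupType).
Implicit Types (C E : {fset G}) (D : set {fset G}).

Definition fsetSum C : {galg F[G]} := \sum_(g <- C) (<< g >> : {galg F[G]}).

Definition fsetInv C : {fset G} := [fset g^-1%g | g in C]%fset.

(* The coefficients are a finitely supported family indexed by finite subsets
   of [G], all of whose support lies in [D]. *)
Definition schur_span D : set {galg F[G]} :=
  [set a | exists lam : {fsfun {fset G} -> F with 0},
     [set` finsupp lam] `<=` D /\
     a = \sum_(E <- finsupp lam) lam E *: fsetSum E].

(* [partition] includes that the parts are non-empty. *)
Record schurRing := SchurRing {
  basic_sets : set {fset G};
  basic_sets_partition :
    partition basic_sets (fun C : {fset G} => [set` C]) [set: G];
  basic_sets1 : basic_sets [fset 1%g]%fset;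
  basic_setsV : forall C, basic_sets C -> basic_sets (fsetInv C);
  basic_setsM : forall C E, basic_sets C -> basic_sets E ->
    schur_span basic_sets (fsetSum C * fsetSum E)
}.

Definition schur_space (A : schurRing) : set {galg F[G]} :=
  schur_span (basic_sets A).

Definition schur_set (A : schurRing) (X : set G) : Prop :=
  exists2 S : set {fset G}, S `<=` basic_sets A & X = \bigcup_(C in S) [set` C].

Definition schur_subgroup (A : schurRing) (X : set G) : Prop :=
  group_closed (mem X) /\ schur_set A X.

End SchurRing.

Coercion schur_space : schurRing >-> set.

Section IntegerPowers.
Context (G : groupType).

Definition zpow (x : G) (n : int) : G :=
  match n with Posz m => (x ^+ m)%g | Negz m => (x ^- m.+1)%g end.

Definition cycgroup (x : G) : set G := range (zpow x).

End IntegerPowers.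

(* [Dih i e] is [z^i s^e]. *)
Variant dih_inf := Dih of int & bool.

Definition dih_pair (x : dih_inf) := let: Dih i e := x in (i, e).
Definition dih_of_pair (p : int * bool) := Dih p.1 p.2.
Lemma dih_pairK : cancel dih_pair dih_of_pair. Proof. by case. Qed.

HB.instance Definition _ := Countable.copy dih_inf (can_type dih_pairK).

Definition dih_one := Dih 0 false.
Definition dih_inv (x : dih_inf) :=
  let: Dih i e := x in Dih (if e then i else - i) e.
Definition dih_mul (x y : dih_inf) :=
  let: Dih i e := x in let: Dih j f := y in
  Dih (i + (if e then - j else j)) (e (+) f).

Lemma dih_mulA : associative dih_mul.
Proof. by case=> i [] [j []] [k []] /=; congr Dih; ring. Qed.
Lemma dih_mul1g : left_id dih_one dih_mul.
Proof. by case=> i e /=; rewrite add0r. Qed.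
Lemma dih_mulg1 : right_id dih_one dih_mul.
Proof. by case=> i [] /=; congr Dih; ring. Qed.
Lemma dih_mulVg : left_inverse dih_one dih_inv dih_mul.
Proof. by case=> i [] /=; congr Dih; ring. Qed.
Lemma dih_mulgV : right_inverse dih_one dih_inv dih_mul.
Proof. by case=> i [] /=; congr Dih; ring. Qed.

HB.instance Definition _ := isGroup.Build dih_inf
  dih_mulA dih_mul1g dih_mulg1 dih_mulVg dih_mulgV.

Definition dih_z : dih_inf := Dih 1 false.
Definition dih_s : dih_inf := Dih 0 true.

Lemma zpow_dih_z i : zpow dih_z i = Dih i false.
Proof.
have zX (n : nat) : (dih_z ^+ n)%g = Dih n%:Z false.
  by elim: n => // n IHn; rewrite expgS IHn -[n.+1]addn1 addnC PoszD.
by case: i => n; rewrite /= zX.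
Qed.

Lemma dihE i e : Dih i e = (zpow dih_z i * (if e then dih_s else 1))%g.
Proof. by rewrite zpow_dih_z; case: e; congr Dih; rewrite addr0. Qed.

(* The next lemmas establish the presentation
   [< z, s : s^2 = 1, s^-1 z s = z^-1 >] of [dih_inf]: the relations hold, [z]
   and [s] generate, and the group is universal for these relations. *)
Lemma dih_rels :
  (dih_s ^+ 2 = 1)%g /\ (dih_s^-1 * dih_z * dih_s = dih_z^-1)%g.
Proof. by []. Qed.

Lemma dih_gen (X : set dih_inf) :
  group_closed (mem X) -> dih_z \in X -> dih_s \in X -> X = [set: dih_inf].
Proof.
move=> grX Xz Xs; have XM := group_closedM grX; have XV := group_closedV grX.
have XX n : (dih_z ^+ n)%g \in X.
  by elim: n => [|n IHn]; [case: grX | rewrite expgS; apply: XM].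
have XZ i : zpow dih_z i \in X by case: i => n; [apply: XX | apply: XV; apply: XX].
apply/seteqP; split=> // -[i e] _; apply: set_mem; rewrite dihE.
by apply: XM => //; case: e => //; case: grX.
Qed.

Section Presentation.
Context (H : groupType) (a b : H).

Lemma zpowS (i : int) : zpow a (1 + i) = (a * zpow a i)%g.
Proof.
case: i => [n|[|n]].
- by rewrite -PoszD add1n /= expgS.
- by rewrite /= expg1 mulgV.
rewrite NegzE (_ : 1 - n.+2%:Z = Negz n) /=; last first.
  by rewrite NegzE -[n.+2]addn1 PoszD; ring.
by rewrite [(a ^+ n.+2)%g]expgSr invgM mulgA mulgV mul1g.
Qed.

Lemma zpowN (i : int) : zpow a (- i) = (zpow a i)^-1%g.
Proof. by case: i => [[|n]|n]; rewrite /= ?invg1 ?invgK. Qed.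

Lemma zpowD (i j : int) : zpow a (i + j) = (zpow a i * zpow a j)%g.
Proof.
have aD (n : nat) k : zpow a (n%:Z + k) = (a ^+ n * zpow a k)%g.
  elim: n => [|n IHn]; first by rewrite add0r mul1g.
  by rewrite -add1n PoszD -addrA zpowS IHn add1n expgS mulgA.
case: i => n; first exact: aD.
apply: (mulgI (a ^+ n.+1)%g); rewrite -aD NegzE addrA subrr add0r.
by rewrite /= mulgA mulgV mul1g.
Qed.

Lemma dih_universal : (b ^+ 2 = 1)%g -> (b^-1 * a * b = a^-1)%g ->
  exists2 f : dih_inf -> H,
    {morph f : x y / (x * y)%g} & f dih_z = a /\ f dih_s = b.
Proof.
move=> b2 abV; have bV : (b^-1 = b)%g by apply: (mulgI b); rewrite mulgV -b2.
have baN i : (b * zpow a i = zpow a (- i) * b)%g.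
  have baX n : (b * a ^+ n = a ^- n * b)%g.
    elim: n => [|n IHn]; first by rewrite invg1 mulg1 mul1g.
    rewrite expgSr mulgA IHn -mulgA invgM.
    have -> : (b * a = a^-1 * b)%g by rewrite -abV bV -mulgA -expg2 b2 mulg1.
    by rewrite mulgA; congr (_ * _)%g; rewrite -!invgM -expgS -expgSr.
  case: i => n; first by rewrite zpowN baX.
  rewrite zpowN /= invgK; apply: (mulgI (a ^- n.+1)%g).
  by rewrite mulgA -baX -mulgA mulgV mulg1 mulgA mulVg mul1g.
exists (fun x => let: Dih i e := x in zpow a i * (if e then b else 1))%g.
  case=> i [] [j f] /=; rewrite zpowD -!mulgA; congr (_ * _)%g.
    by rewrite mulgA baN -mulgA; case: f; rewrite /= ?mulg1 // -expg2 b2 mulg1.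
  by rewrite mul1g.
by rewrite /= expg1 mulg1 mul1g.
Qed.

End Presentation.

Definition dih_refl (i : int) : dih_inf := (zpow dih_z i * dih_s)%g.

Section ReflectionDifferences.
Context (F : fieldType) (A : schurRing F dih_inf).

Definition refl_diffs : set int :=
  [set d | exists D i j, [/\ basic_sets A D, dih_refl i \in D,
     dih_refl j \in D & d = i - j]].

Definition refl_absdiffs : set int :=
  [set d | exists D i j, [/\ basic_sets A D, dih_refl i \in D,
     dih_refl j \in D, i != j & d = `|i - j|]].

End ReflectionDifferences.

Definition is_max (S : set int) (m : int) : Prop := S m /\ ubound S m.
Definition is_min (S : set int) (m : int) : Prop := S m /\ lbound S m.

(* Main.v *)
Require Import Defs.
From mathcomp Require Import all_boot all_order all_algebra.
From mathcomp Require Import finmap monalg.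
From mathcomp Require Import boolp classical_sets.
From mathcomp Require Import cyclic zify ring.

Set Implicit Arguments.
Unset Strict Implicit.
Unset Printing Implicit Defensive.

Import Order.TTheory GRing.Theory Num.Theory.

Local Open Scope fset_scope.
Local Open Scope classical_set_scope.
Local Open Scope ring_scope.

(* In characteristic 0, the number of factorizations x = a b with a, b in a
   basic set D depends only on the basic set of x, and its parity can be read off
   from involutions on these factorizations.  If D contains a reflection, then
   D = D^*, so every reflection has an even number of them; hence z^n lies in a
   basic set of rotations as soon as its own number is odd.

   (ii) If r were the only reflection of C, then z^2 would have an odd number of
   factorizations in C (only z.z is fixed by the swap), so its basic set E would
   be in <z>.  From z = z^-1 z^2 in C E we would get r in C E, forcing 1 in E.

   (iii) The maximum l is never odd.  Suppose it is, attained by z^i s, z^(i-l) s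
   in D.  Then z^l has an odd number of factorizations in D, so its basic set E
   is in <z>; by the parity argument for squares, the basic set of z^(2^N l) is in
   {z^(2^N k) : z^k in E}, and the largest exponent m of E is odd.  Being the
   reflections of one basic set at maximal distance l is a property of the pair
   (z^v s, z^(v-l) s) that is kept under v -> v - m and, if 2^N > 2 l, under
   v -> v + 2^N l.  With 2^N = 1 mod m this moves v = i to v = i + l, which puts
   z^(i+l) s and z^(i-l) s in the same basic set, at distance 2 l > l. *)

(** * Parity and involutions *)

Lemma odd_size_involution (T : eqType) (f : T -> T) (s : seq T) : uniq s ->
  {in s, forall x, f x \in s} -> {in s, forall x, f (f x) = x} ->
  odd (size s) = odd (count (fun x => f x == x) s).
Proof.
have [n] := ubnP (size s); elim: n s => // n IHn [|x s] //= ltn /andP[xs us].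
move=> fs fK; have fin y : y \in x :: s -> f y \in x :: s := fs y.
have fKin y : y \in x :: s -> f (f y) = y := fK y.
have xin : x \in x :: s by rewrite mem_head.
have sin y : y \in s -> y \in x :: s by move=> ys; rewrite in_cons ys orbT.
have [fx|fx] := eqVneq (f x) x.
  rewrite add1n /= (IHn s) // => y ys; last exact/fKin/sin.
  move: (fin y (sin y ys)); rewrite in_cons => /predU1P[fyx|//].
  by move: xs; rewrite -fx -fyx fKin ?ys //; apply: sin.
(* Here [x] and [f x] are two distinct non-fixed points; both are dropped before the induction
   hypothesis is applied. *)
have fxs : f x \in s by move: (fin x xin); rewrite in_cons (negPf fx).
have := perm_to_rem fxs => prs.
have cnt := permP prs (fun y => f y == y).
rewrite add0n cnt /= (fKin x xin) eq_sym (negPf fx) add0n.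
rewrite (perm_size prs) /= negbK; apply: IHn.
- by move: ltn; rewrite (perm_size prs) /=; lia.
- exact: rem_uniq.
- move=> y; rewrite !mem_rem_uniq // !inE => /andP[yfx ys].
  apply/andP; split.
    apply/eqP => e; have := fKin y (sin y ys); rewrite e fKin // => yx.
    by rewrite yx ys in xs.
  move: (fin y (sin y ys)); rewrite in_cons => /predU1P[fyx|//].
  by rewrite -fyx fKin ?eqxx // in yfx; apply: sin.
- by move=> y; rewrite mem_rem_uniq // inE => /andP[_ ys]; apply/fKin/sin.
Qed.

(** * Numbers of factorizations in an arbitrary Schur ring *)

Section BasicSets.
Context (F : fieldType) (charF0 : [pchar F] =i pred0).
Context (G : groupType) (A : schurRing F G).
Implicit Types (B C D E : {fset G}) (x y g h : G).

Lemma basic_set_ex x : exists2 D, basic_sets A D & x \in D.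
Proof.
have [cov _ _] := basic_sets_partition A.
have : setT x by [].
by rewrite -cov => -[D AD /= xD]; exists D.
Qed.

Lemma basic_set_eq C D x :
  basic_sets A C -> basic_sets A D -> x \in C -> x \in D -> C = D.
Proof.
have [_ triv _] := basic_sets_partition A.
by move=> AC AD xC xD; apply: triv => //; exists x.
Qed.

Lemma mem_fsetInv C x : (x \in fsetInv C) = (x^-1%g \in C).
Proof.
apply/imfsetP/idP => /= [[y yC ->]|xC]; first by rewrite invgK.
by exists x^-1%g; rewrite ?invgK.
Qed.

(** The left factor [g] determines the right one, so this is the coefficient at [x] of the product
    of the two sums. *)
Definition factorizations C D x : nat :=
  count (fun g => (g^-1 * x)%g \in D) (enum_fset C).

Lemma mcoeff_fsetSum C x : mcoeff x (fsetSum F C) = (x \in C)%:R.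
Proof.
rewrite /fsetSum raddf_sum /=; under eq_bigr do rewrite mcoeffU.
rewrite -natr_sum -(count_uniq_mem _ (fset_uniq C)) -sum1_count.
congr (_%:R); rewrite [RHS]big_mkcond /=.
by apply: eq_bigr => g _; case: (g == x).
Qed.

Lemma mcoeff_fsetSumM C D x :
  mcoeff x (fsetSum F C * fsetSum F D) = (factorizations C D x)%:R.
Proof.
rewrite {1}/fsetSum mulr_suml raddf_sum /=.
rewrite /factorizations -sum1_count [in RHS]big_mkcond natr_sum /=.
apply: eq_bigr => g _; rewrite /fsetSum mulr_sumr raddf_sum /=.
rewrite -[_%:R]/(nat_of_bool ((g^-1 * x)%g \in D))%:R -mcoeff_fsetSum.
rewrite /fsetSum raddf_sum /=; apply: eq_bigr => h _.
rewrite [_ * _]galg_mulUU mul1r !mcoeffU; congr (_ *+ nat_of_bool _).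
by apply/eqP/eqP => [<-|->]; rewrite ?mulKg ?mulVKg.
Qed.

(** The product is a combination of sums over basic sets, so its coefficients are constant on [B];
    in characteristic 0 they determine the natural numbers. *)
Lemma factorizations_const C D B x y : basic_sets A C -> basic_sets A D ->
  basic_sets A B -> x \in B -> y \in B ->
  factorizations C D x = factorizations C D y.
Proof.
move=> AC AD AB xB yB; have [lam [lamA eq]] := basic_setsM AC AD.
have nat_eq m n : m%:R = n%:R :> F -> m = n.
  wlog le : m n / (m <= n)%N => [wl e|/esym/eqP].
    by case/orP: (leq_total m n) => le; [apply: wl|apply/esym/wl].
  rewrite -subr_eq0 -natrB // ((GRing.pcharf0P _).1 charF0) subn_eq0 => le'.
  by apply/eqP; rewrite eqn_leq le.
apply: nat_eq; rewrite -!mcoeff_fsetSumM eq !raddf_sum /=.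
rewrite !big_seq; apply: eq_bigr => E /lamA AE.
rewrite !mcoeffZ !mcoeff_fsetSum; congr (_ * _%:R).
congr nat_of_bool; apply/idP/idP => inE.
  by rewrite -(basic_set_eq AB AE xB inE).
by rewrite -(basic_set_eq AB AE yB inE).
Qed.

Lemma basic_setM_sub C D B g h y : basic_sets A C -> basic_sets A D ->
  basic_sets A B -> g \in C -> h \in D -> (g * h)%g \in B -> y \in B ->
  exists2 g', g' \in C & (g'^-1 * y)%g \in D.
Proof.
move=> AC AD AB gC hD ghB yB.
have : (0 < factorizations C D y)%N.
  rewrite -(factorizations_const AC AD AB ghB yB) -has_count.
  by apply/hasP; exists g => //; rewrite mulKg.
by rewrite -has_count => /hasP[g' g'C g'y]; exists g'.
Qed.

End BasicSets.

(** * Rotations and reflections in basic sets *)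

Definition rotation : pred dih_inf := fun x => let: Dih _ e := x in ~~ e.

Lemma dih_reflE i : dih_refl i = Dih i true.
Proof. by rewrite /dih_refl zpow_dih_z; congr Dih; rewrite addr0. Qed.

Lemma cycgroup_dih_zP x : cycgroup dih_z x <-> rotation x.
Proof.
split=> [[i _ <-]|]; first by rewrite zpow_dih_z.
by case: x => i [] // _; exists i; rewrite // zpow_dih_z.
Qed.

Section DihedralBasicSets.
Context (F : fieldType) (charF0 : [pchar F] =i pred0).
Context (A : schurRing F dih_inf).
Implicit Types (B C D E : {fset dih_inf}) (x y g h : dih_inf) (i j k m n : int).

(** These [n] form a subgroup of the integers, so [n = 1] suffices to make [<z>] an A-subgroup. *)
Definition rotation_class n : Prop :=
  exists D, [/\ basic_sets A D, Dih n false \in D & {in D, forall x, rotation x}].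

Lemma rotation_classD m n :
  rotation_class m -> rotation_class n -> rotation_class (m + n).
Proof.
move=> [C [AC mC rC]] [D [AD nD rD]].
have [B AB mnB] := basic_set_ex A (Dih (m + n) false).
exists B; split=> // x xB.
have [g gC] := basic_setM_sub charF0 AC AD AB mC nD mnB xB.
by move/rD; move/rC: gC; case: g x {xB} => [? []] [? []].
Qed.

Lemma rotation_classN n : rotation_class n -> rotation_class (- n).
Proof.
move=> [C [AC nC rC]]; exists (fsetInv C); split.
- exact: basic_setsV.
- by rewrite mem_fsetInv (_ : _^-1 = Dih n false)%g //; congr Dih; rewrite opprK.
- by move=> x; rewrite mem_fsetInv => /rC; case: x.
Qed.

Lemma rotation_class0 : rotation_class 0.
Proof.
by exists [fset 1%g]; split; [exact: basic_sets1|rewrite inE|move=> x /fset1P ->].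
Qed.

Lemma rotation_classM k n : rotation_class n -> rotation_class (k * n).
Proof.
move=> rn; have rnat p : rotation_class (Posz p * n).
  elim: p => [|p IHp]; first by rewrite mul0r; apply: rotation_class0.
  by rewrite -addn1 PoszD mulrDl mul1r; apply: rotation_classD.
case: k => p //; rewrite NegzE mulNr; exact/rotation_classN.
Qed.

Lemma fsetInv_refl D i : basic_sets A D -> Dih i true \in D -> fsetInv D = D.
Proof.
by move=> AD iD; apply: (basic_set_eq (basic_setsV AD) AD _ iD); rewrite mem_fsetInv.
Qed.

(* The pairs [(a, b)] with [a b = r] are permuted by [(a, b) -> (b^-1, a^-1)]
   without fixed points. *)
Lemma even_factorizations_refl D i j : basic_sets A D -> Dih i true \in D ->
  ~~ odd (factorizations D D (Dih j true)).
Proof.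
move=> AD iD; have DV := fsetInv_refl AD iD.
set r := Dih j true; have rV : (r^-1 = r)%g by [].
have rr : (r * r = 1)%g by rewrite -{1}rV mulVg.
have rgr g : ((r * g)^-1 * r = g^-1)%g by rewrite invgM rV -mulgA rr mulg1.
rewrite /factorizations -size_filter.
rewrite (@odd_size_involution _ (fun g => (r * g)%g)).
- rewrite (@eq_count _ _ pred0) ?count_pred0 // => g /=.
  by apply/eqP => /(congr1 (fun h => (h * g^-1)%g)); rewrite mulgK mulgV.
- by rewrite filter_uniq ?fset_uniq.
- move=> g; rewrite !mem_filter => /andP[gr gD].
  have {}gD : g \in D := gD; rewrite rgr -mem_fsetInv DV gD /=.
  by rewrite -[_ \in _]/((r * g)%g \in D) -DV mem_fsetInv invgM rV.
- by move=> g _; rewrite mulgA rr mul1g.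
Qed.

(** A reflection in the basic set of [z^n] would share its odd number of factorizations. *)
Lemma rotation_class_odd D i n : basic_sets A D -> Dih i true \in D ->
  odd (factorizations D D (Dih n false)) -> rotation_class n.
Proof.
move=> AD iD oddn; have [E AE nE] := basic_set_ex A (Dih n false).
exists E; split=> // -[k []] // kE.
have := even_factorizations_refl k AD iD.
by rewrite (factorizations_const charF0 AD AD AE kE nE) oddn.
Qed.

(* Swapping the two factors is an involution on the rotation factorizations of
   [z^n] with only the square root of [z^n] as a fixed point. *)
Definition swap_factor n g : dih_inf :=
  if g is Dih k false then Dih (n - k) false else g.

(** Besides the square root of [z^n], this admits the factorizations into two reflections, which
    [swap_factor] leaves alone. *)
Definition swap_fixed D n g :=
  (swap_factor n g == g) && ((g^-1 * Dih n false)%g \in D).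

Lemma odd_factorizationsE D n :
  odd (factorizations D D (Dih n false)) = odd (count (swap_fixed D n) (enum_fset D)).
Proof.
rewrite /factorizations -size_filter (@odd_size_involution _ (swap_factor n)).
- by rewrite count_filter.
- by rewrite filter_uniq ?fset_uniq.
- move=> g; rewrite !mem_filter => /andP[gn gD].
  have {}gD : g \in D := gD; apply/andP; case: g gn gD => k [] // kn kD; split=> //.
    by rewrite (_ : _ * _ = Dih k false)%g //; congr Dih; ring.
  by rewrite -[_ \in _]/(Dih (n - k) false \in D) addrC.
- by case=> k [] // _; congr Dih; ring.
Qed.

Lemma odd_factorizations1 D n g : g \in D ->
  {in D, forall h, swap_fixed D n h = (h == g)} ->
  odd (factorizations D D (Dih n false)).
Proof.
move=> gD Dg; rewrite odd_factorizationsE.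
by rewrite (eq_in_count (a2 := pred1 g)) // count_uniq_mem ?fset_uniq // gD.
Qed.

Lemma rotation_double D E n : basic_sets A D -> Dih n false \in D ->
  {in D, forall x, rotation x} -> basic_sets A E -> Dih (2 * n) false \in E ->
  forall x, x \in E -> exists2 k, x = Dih (2 * k) false & Dih k false \in D.
Proof.
move=> AD nD rD AE nE x xE.
(* Among rotations the swap fixes only [z^n z^n], so the count is odd at [z^(2n)], hence on [E]. An
   odd count in turn forces a fixed factor, a square root of [x] in [D]. *)
have oddx : odd (factorizations D D x).
  rewrite (factorizations_const charF0 AD AD AE xE nE).
  apply: (odd_factorizations1 nD) => -[k e kD]; have := rD _ kD.
  case: e kD => // kD _; rewrite /swap_fixed /=.
  apply/andP/eqP => [[/eqP[e] _]|[->]]; first by congr Dih; lia.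
  split; first by apply/eqP; congr Dih; ring.
  by rewrite (_ : _ * _ = Dih n false)%g //; congr Dih; ring.
have rx : rotation x.
  have nnE : (Dih n false * Dih n false)%g \in E.
    by rewrite (_ : _ * _ = Dih (2 * n) false)%g //; congr Dih; ring.
  have [g gD] := basic_setM_sub charF0 AD AD AE nD nD nnE xE.
  by move/rD; move/rD: gD; case: g x {xE oddx} => [? []] [? []].
case: x rx xE oddx => j [] // _ jE; rewrite odd_factorizationsE => oddj.
have /hasP[g gD /andP[gfix _]] : has (swap_fixed D j) (enum_fset D).
  by rewrite has_count; case: count oddj.
have {}gD : g \in D := gD; have := rD _ gD; case: g gfix gD => k [] //= /eqP[e] kD _.
by exists k => //; congr Dih; lia.
Qed.

Lemma rotation_pow2 D n (N : nat) : basic_sets A D -> Dih n false \in D ->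
  {in D, forall x, rotation x} ->
  exists E, [/\ basic_sets A E, Dih (2 ^+ N * n) false \in E &
    forall x, x \in E -> exists2 k, x = Dih (2 ^+ N * k) false & Dih k false \in D].
Proof.
move=> AD nD rD; elim: N => [|N [E [AE nE ED]]].
  exists D; split; rewrite ?mul1r // => -[k e] kD; have := rD _ kD.
  by case: e kD => // kD _; exists k; rewrite ?mul1r.
have rE : {in E, forall x, rotation x} by move=> x /ED[k ->].
have [E' AE' nE'] := basic_set_ex A (Dih (2 ^+ N.+1 * n) false).
exists E'; split=> // x xE'; rewrite exprS -mulrA in nE'.
have [k -> /ED[k' [->] k'D]] := rotation_double AE nE rE AE' nE' xE'.
by exists k'; rewrite // exprS mulrA.
Qed.

(** * Shifting pairs of reflections at maximal distance *)

Definition refl_pair l v : Prop :=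
  exists D, [/\ basic_sets A D, Dih v true \in D & Dih (v - l) true \in D].

(* A basic set containing [z^(v - l + w) s] must contain some [z^(v + w') s] with
   [w'] in [W], and the bound [l] forces [w - 2 l <= w' <= w]. *)
Lemma refl_pair_shift l W w v :
  (forall D i j, basic_sets A D -> Dih i true \in D -> Dih j true \in D ->
     i - j <= l) ->
  basic_sets A W -> {in W, forall x, rotation x} -> Dih w false \in W ->
  (forall k, Dih k false \in W -> k < w -> k < w - 2 * l) ->
  refl_pair l v -> refl_pair l (v + w).
Proof.
move=> lmax AW rW wW gapW [D [AD vD vlD]].
have [B AB vwB] := basic_set_ex A (Dih (v + w - l) true).
have wWV : Dih (- w) false \in fsetInv W.
  by rewrite mem_fsetInv (_ : _^-1 = Dih w false)%g //; congr Dih; rewrite opprK.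
have vlD' : (Dih (- w) false * Dih (v + w - l) true)%g \in D.
  by rewrite (_ : _ * _ = Dih (v - l) true)%g //; congr Dih; ring.
have [g gWV gB] := basic_setM_sub charF0 (basic_setsV AW) AB AD wWV vwB vlD' vD.
rewrite mem_fsetInv in gWV; move: (g^-1%g) gWV gB => [k e] kW; have := rW _ kW.
case: e kW => // kW _; rewrite (_ : _ * _ = Dih (k + v) true)%g // => kB.
have le1 := lmax _ _ _ AB kB vwB; have le2 := lmax _ _ _ AB vwB kB.
have kw : k = w.
  by have [lt|ge] := ltP k w; [have := gapW _ kW lt | ]; lia.
by exists B; split=> //; rewrite addrC -kw.
Qed.

Lemma rotation_max E n : Dih n false \in E -> {in E, forall x, rotation x} ->
  exists2 m, Dih m false \in E & forall k, Dih k false \in E -> k <= m.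
Proof.
move=> nE rE; pose f (x : E) : int := let: Dih k _ := val x in k.
have [[[m e] mE] _ maxm] := @Order.TotalTheory.arg_maxP _ _ E [` nE]%fset predT f isT.
have := rE _ mE; case: e mE maxm => // mE maxm _; exists m => // k kE.
exact: (maxm [` kE]%fset).
Qed.

End DihedralBasicSets.

(** * The three statements *)

Lemma pow2_eq1_mod (m b : nat) : odd m ->
  exists N c : nat, (2 ^ N = c * m + 1)%N /\ (b < 2 ^ N)%N.
Proof.
move=> oddm; have m0 : (0 < m)%N by case: m oddm.
(* The totient gives [2^N = 1] mod [m] by Euler's theorem; the factor [b.+1] makes [N], hence [2^N],
   exceed [b]. *)
pose N := (totient m * b.+1)%N; exists N, ((2 ^ N - 1) %/ m)%N; split.
  rewrite divnK ?subnK ?expn_gt0 // -eqn_mod_dvd ?expn_gt0 //.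
  by rewrite expnM -modnXm Euler_exp_totient ?coprime2n // modnXm exp1n.
apply: (leq_trans _ (ltnW (ltn_expl N (isT : 1 < 2)%N))).
by rewrite -[b.+1]mul1n leq_mul // totient_gt0.
Qed.

Lemma cycgroup_schur_subgroup (F : fieldType) (charF0 : [pchar F] =i pred0)
    (A : schurRing F dih_inf) :
  rotation_class A 1 -> schur_subgroup A (cycgroup dih_z).
Proof.
move=> r1; split.
  split; first by apply/mem_set/cycgroup_dih_zP.
  move=> x y /set_mem/cycgroup_dih_zP rx /set_mem/cycgroup_dih_zP ry.
  by apply/mem_set/cycgroup_dih_zP; case: x y rx ry => [? []] [? []].
exists [set D | basic_sets A D /\ {in D, forall x, rotation x}].
  by move=> D [].
apply/seteqP; split=> [x /cycgroup_dih_zP|x [D [_ rD] xD]]; last first.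
  exact/cycgroup_dih_zP/rD.
case: x => k [] // _; have := rotation_classM charF0 k r1; rewrite mulr1.
by move=> [D [AD kD rD]]; exists D.
Qed.

Lemma rotation_in_basic_set_two_refl (F : fieldType)
    (charF0 : [pchar F] =i pred0) (A : schurRing F dih_inf)
    (C : {fset dih_inf}) (n i : int) :
  basic_sets A C -> n != 0 -> Dih n false \in C -> Dih i true \in C ->
  exists2 j, i != j & Dih j true \in C.
Proof.
move=> AC n0 nC iC; apply: contrapT => noj.
have Ci j : Dih j true \in C -> j = i.
  by move=> jC; apply/eqP; rewrite eq_sym; apply: contra_notT noj => ij; exists j.
have CV := fsetInv_refl AC iC.
have [E [AE nE rE]] : rotation_class A (2 * n).
  apply: (rotation_class_odd charF0 AC iC); apply: (odd_factorizations1 nC).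
  (* Two reflections of [C] would both be [z^i s], with product 1. *)
  move=> -[k [|]] kC; rewrite /swap_fixed /=.
    apply/andP/eqP => // -[_]; rewrite (_ : _ * _ = Dih (k - 2 * n) true)%g //.
    by move=> /Ci; rewrite (Ci _ kC) => e; exfalso; move/eqP: n0; lia.
  apply/andP/eqP => [[/eqP[e] _]|[->]]; first by congr Dih; lia.
  split; first by apply/eqP; congr Dih; ring.
  by rewrite (_ : _ * _ = Dih n false)%g //; congr Dih; ring.
have nVC : Dih (- n) false \in C.
  by rewrite -CV mem_fsetInv (_ : _^-1 = Dih n false)%g //; congr Dih; rewrite opprK.
have nEC : (Dih (- n) false * Dih (2 * n) false)%g \in C.
  by rewrite (_ : _ * _ = Dih n false)%g //; congr Dih; ring.
have [g gC gE] := basic_setM_sub charF0 AC AE AC nVC nE nEC iC.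
(* [g^-1 z^i s] is in [E], hence a rotation, so [g] is a reflection of [C]. *)
have ir : g = Dih i true by have := rE _ gE; case: g gC {gE} => [? []] // /Ci ->.
have E1 : E = [fset 1%g].
  by apply: (basic_set_eq AE (basic_sets1 A) gE); rewrite ir mulVg inE.
move: nE; rewrite E1 => /fset1P [e]; move/eqP: n0; lia.
Qed.

Lemma refl_diffs_max_even (F : fieldType) (charF0 : [pchar F] =i pred0)
    (A : schurRing F dih_inf) (l : int) :
  is_max (refl_diffs A) l -> (2 %| l)%Z.
Proof.
move=> [[D [i [j [AD iD jD lij]]]] lub]; rewrite !dih_reflE in iD jD.
have lmax B i' j' : basic_sets A B -> Dih i' true \in B -> Dih j' true \in B ->
    i' - j' <= l.
  by move=> AB iB jB; apply: lub; exists B, i', j'; rewrite !dih_reflE.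
apply: contrapT => /negP oddl.
have l0 : 0 < l by have := lmax _ _ _ AD iD iD; lia.
have [E [AE lE rE]] : rotation_class A l.
  apply: (rotation_class_odd charF0 AD iD); apply: (odd_factorizations1 iD).
  (* Maximality of [l] leaves [z^i s] as the only reflection factor; a fixed rotation would make [l]
     even. *)
  move=> -[k [|]] kD; rewrite /swap_fixed /= ?eqxx.
    rewrite (_ : _ * _ = Dih (k - l) true)%g //.
    apply/idP/eqP => [klD|[->]]; last by rewrite lij opprB addrC subrK.
    have le1 := lmax _ _ _ AD kD jD; have le2 := lmax _ _ _ AD iD klD.
    by congr Dih; lia.
  by apply/andP/eqP => // -[/eqP[e]]; lia.
have [m mE maxm] := rotation_max lE rE.
have oddm : ~~ (2 %| m)%Z.
  (* If [m = 2 k] and [l = 2 q + 1], then [k = k l - q m] is a rotation exponent, and doubling [k]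
     makes all exponents of [E] even, [l] included. *)
  apply/negP => m2; have [k mk] : exists k, m = 2 * k by exists (m %/ 2)%Z; lia.
  have [K [AK kK rK]] : rotation_class A k.
    have [q lq] : exists q, l = 2 * q + 1 by exists (l %/ 2)%Z; lia.
    rewrite (_ : k = k * l + (- q) * m); last by rewrite lq mk; ring.
    by apply: rotation_classD => //; apply: rotation_classM => //; exists E.
  rewrite mk in mE; have [? [e]] := rotation_double charF0 AK kK rK AE mE lE.
  by lia.
have lm := maxm _ lE.
have [N [c [powN ltN]]] := @pow2_eq1_mod `|m|%N `|(2 * l)%R|%N ltac:(lia).
have pow2 : 2 ^+ N = c%:Z * m + 1 by rewrite -natrX natz powN; lia.
have pair0 : refl_pair A l i by exists D; split=> //; rewrite lij opprB addrC subrK.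
have pair1 : refl_pair A l (i + 2 ^+ N * l).
  have [W [AW wW WE]] := rotation_pow2 charF0 N AE lE rE.
  apply: (refl_pair_shift charF0 lmax AW) wW _ pair0; first by move=> x /WE[k ->].
  move=> k /WE[k' [->] _] lt.
  (* Exponents in [W] are multiples of [2^N], hence at least [2^N > 2 l] apart. *)
  have : 2 ^+ N * (l - k') >= 2 ^+ N * 1.
    by rewrite ler_pM2l ?exprn_gt0 //; move: lt; rewrite ltr_pM2l ?exprn_gt0 //; lia.
  by rewrite mulrBr mulr1; lia.
have pair2 (b : nat) v : refl_pair A l v -> refl_pair A l (v - b%:Z * m).
  move=> pv; elim: b => [|b IHb]; first by rewrite mul0r subr0.
  rewrite (_ : v - _ = v - b%:Z * m + - m); last by rewrite -addn1 PoszD; ring.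
  apply: (refl_pair_shift charF0 lmax (basic_setsV AE)) _ _ _ IHb.
  - by move=> x; rewrite mem_fsetInv => /rE; case: x.
  - by rewrite mem_fsetInv (_ : _^-1 = Dih m false)%g //; congr Dih; rewrite opprK.
  (* The gap condition is vacuous: [-m] is the least exponent of [E^*]. *)
  - by move=> k; rewrite mem_fsetInv => /maxm; lia.
have [B [AB ilB iB]] : refl_pair A l (i + l).
  (* [2^N l - c l m = l], since [2^N = c m + 1]. *)
  have := pair2 (c * `|l|)%N _ pair1; rewrite pow2 PoszM.
  congr refl_pair; rewrite (_ : `|l|%:Z = l); [ring|lia].
rewrite addrK in iB; rewrite (basic_set_eq AB AD iB iD) in ilB.
by have := lmax _ _ _ AD ilB jD; lia.
Qed.

Theorem proposition1p1 (F : fieldType) (charF0 : [pchar F] =i pred0)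
    (A : schurRing F dih_inf) (C : {fset dih_inf})
    (basicC : basic_sets A C) (zC : dih_z \in C) :
  [/\ [set` C] `<=` cycgroup dih_z -> schur_subgroup A (cycgroup dih_z),
      (exists i : int, dih_refl i \in C) ->
        exists i j : int, [/\ i != j, dih_refl i \in C & dih_refl j \in C]
    & forall l t : int,
        is_max (refl_diffs A) l -> is_min (refl_absdiffs A) t ->
        ~~ (2 %| l)%Z -> 2 < t ->
        schur_subgroup A (cycgroup dih_z)].
Proof.
split.
- move=> CZ; apply: cycgroup_schur_subgroup => //; exists C; split=> // x xC.
  exact/cycgroup_dih_zP/CZ.
- move=> [i]; rewrite dih_reflE => iC.
  have [j ij jC] :=
    rotation_in_basic_set_two_refl charF0 basicC (oner_neq0 int) zC iC.
  by exists i, j; rewrite !dih_reflE.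
- by move=> l t /(refl_diffs_max_even charF0) ->.
Qed.
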